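(* Let $n \ge 9$ and let $\rho: B_n \to GL_n(\mathbb{C})$ be an irreducible complex representation of dimension $n$. Then $\rho$ is equivalent to a tensor product $\chi(y) \otimes \rho'$, where $y \in \mathbb{C}^*$, $\chi(y)$ is the one-dimensional representation with $\chi(y)(\sigma_i) = y$ for all $i$, and $\rho': B_n \to GL_n(\mathbb{C})$ is an $n$-dimensional representation of corank $2$. Equivalently, there exists $y \in \mathbb{C}^*$ with $\mathrm{rank}(\rho(\sigma_1) - yI) = 2$. *)

(* Defs.v *)
From HB Require Import structures.
From mathcomp Require Import all_boot all_order all_algebra.
From mathcomp Require Import complex reals Rstruct.
Set Implicit Arguments. Unset Strict Implicit. Unset Printing Implicit Defensive.
Import Order.TTheory GRing.Theory Num.Theory.
Local Open Scope ring_scope.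

Definition C : numClosedFieldType := complex Rdefinitions.R.

(* A representation rho : B_n -> GL_m(C) of the braid group on n strands
   (Artin presentation: generators sigma_1..sigma_{n-1}, indexed here by
   'I_n.-1, i.e. sigma_{i+1} <-> i) is given by the images
   A i = rho(sigma_{i+1}); such a family defines a homomorphism iff the
   A i are invertible and satisfy the braid relations. *)
Definition braid_rep (n m : nat) (A : 'I_n.-1 -> 'M[C]_m) : Prop :=
  [/\ forall i, A i \in unitmx,
      forall i j : 'I_n.-1, j.+1 = i.+1 + 1 ->
        A i *m A j *m A i = A j *m A i *m A j
    & forall i j : 'I_n.-1, i.+1 + 2 <= j.+1 ->
        A i *m A j = A j *m A i]%N.

(* Irreducible: the only subspaces of C^m (row vectors, acted on by right
   multiplication) stable under all rho(sigma_i) are 0 and C^m. *)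
Definition braid_irreducible (n m : nat) (A : 'I_n.-1 -> 'M[C]_m) : Prop :=
  forall U : 'M[C]_m, (forall i, stablemx U (A i)) ->
    (U == (0 : 'M[C]_m))%MS \/ row_full U.

Definition braid_corank (n m : nat) (A : 'I_n.-1 -> 'M[C]_m) (k : nat) : Prop :=
  forall i : 'I_n.-1, i = 0%N :> nat -> \rank (A i - 1%:M) = k.

(* Main.v *)
Require Import Defs.
From HB Require Import structures.
From mathcomp Require Import all_boot all_order all_algebra.
From mathcomp Require Import complex reals Rstruct.
From mathcomp Require Import boolp zify.
Import Order.TTheory GRing.Theory Num.Theory.
Local Open Scope ring_scope.
Set Implicit Arguments.
Unset Strict Implicit.
Unset Printing Implicit Defensive.

(* Write sigma_1, .., sigma_(n-1) for the generators and call a representation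
   constant when they all act in the same way.

   1. Every representation of B_m of dimension at most m - 3 (m >= 5) is
      constant. In the irreducible case some eigenspace of sigma_1 has dimension
      at least 2, since otherwise there is a common eigenvector. The eigenspace
      and its quotient are acted on by <sigma_3, ..> = B_(m-2), so induction
      applies unless sigma_1 - y has rank 1, which is settled by step 3.
   2. Suppose rank (sigma_1 - y) > 4 for all y. By step 1, B_(n-2) is constant on
      each cokernel of sigma_1 - y, hence, filtering by the factors of the
      characteristic polynomial of sigma_1, on the whole space; a contradiction.
      So, after scaling, X_i = sigma_i - 1 has rank r <= 4 and, by step 1 again,
      the distant generators act alike on the image of X_i.
   3. Then all products X_i X_j with |i - j| >= 2 are equal, their common image
      is invariant, and they vanish. The sums of the images of X_1, .., X_k grow
      strictly up to k = n - 2, and the images of X_1 and X_3 are independent,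
      so n >= 2 r + (n - 5), that is r <= 2. If r = 1 the n - 1 images cannot
      span the space.

   Generators are numbered from 0 below: sigma_(i+1) is [a i], and N = n - 1. *)

(** * Matrix families satisfying the braid relations *)

Section Generalities.
Variable F : fieldType.

(** Indexing by [nat], with conditions only below [N], makes prefixes and shifted suffixes families
    of the same type. *)
Definition braid (N d : nat) (a : nat -> 'M[F]_d) : Prop :=
  [/\ forall i, (i < N)%N -> a i \in unitmx,
      forall i, (i.+1 < N)%N ->
        a i *m a i.+1 *m a i = a i.+1 *m a i *m a i.+1
    & forall i j, (i.+1 < j)%N -> (j < N)%N -> a i *m a j = a j *m a i].

Definition const_family (N d : nat) (a : nat -> 'M[F]_d) : Prop :=
  forall i j, (i < N)%N -> (j < N)%N -> a i = a j.

Definition irreducible (N d : nat) (a : nat -> 'M[F]_d) : Prop :=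
  forall U : 'M[F]_d, (forall i, (i < N)%N -> stablemx U (a i)) ->
    U = 0 \/ row_full U.

Definition const_dim (N d : nat) : Prop :=
  forall b : nat -> 'M[F]_d, braid N b -> const_family N b.

Lemma unitmx_inj (m d : nat) (g : 'M[F]_d) (U V : 'M[F]_(m, d)) :
  g \in unitmx -> U *m g = V *m g -> U = V.
Proof. by move=> ug e; rewrite -(mulmxK ug U) e mulmxK. Qed.

Lemma unitmx_injl (m d : nat) (g : 'M[F]_d) (U V : 'M[F]_(d, m)) :
  g \in unitmx -> g *m U = g *m V -> U = V.
Proof. by move=> ug e; rewrite -(mulKmx ug U) e mulKmx. Qed.

Lemma intertwine_inv (d : nat) (g x y : 'M[F]_d) :
  g \in unitmx -> g *m x = y *m g -> x *m invmx g = invmx g *m y.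
Proof. by move=> ug e; rewrite -{1}(mulKmx ug x) e mulmxA mulmxK. Qed.

Lemma intertwine_sub_scalar (d : nat) (g x y : 'M[F]_d) (c : F) :
  g *m x = y *m g -> g *m (x - c%:M) = (y - c%:M) *m g.
Proof. by move=> e; rewrite mulmxBl mulmxBr e scalar_mxC. Qed.

Lemma braid_commute_eq (d : nat) (x y : 'M[F]_d) :
  x \in unitmx -> y \in unitmx ->
  x *m y *m x = y *m x *m y -> x *m y = y *m x -> x = y.
Proof.
move=> ux uy b c; apply: (@unitmx_injl _ _ (x *m y)).
  by rewrite unitmx_mul ux.
by rewrite b c.
Qed.

Section Family.
Variables (N d : nat) (a : nat -> 'M[F]_d).
Hypothesis ha : braid N a.

Lemma braid_far_comm (i j : nat) :
  (i < N)%N -> (j < N)%N -> (i.+1 < j)%N || (j.+1 < i)%N ->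
  a i *m a j = a j *m a i.
Proof.
by case: ha => _ _ hc iN jN /orP[] h; [|symmetry]; apply: hc.
Qed.

Lemma const_of_adjacent : (forall i, (i.+1 < N)%N -> a i = a i.+1) ->
  const_family N a.
Proof.
move=> h.
have h0 i : (i < N)%N -> a i = a 0%N.
  by elim: i => // i ih hi; rewrite -h // ih //; lia.
by move=> i j iN jN; rewrite (h0 i) // (h0 j).
Qed.

(** Since [a k] commutes with [a k.+2], so does [a k.+1], and [braid_commute_eq] makes the latter
    two equal; likewise downwards. *)
Lemma const_of_adjacent_eq (k : nat) : (k.+1 < N)%N -> a k = a k.+1 ->
  const_family N a.
Proof.
case: (ha) => hu hb hc kN e.
have up l : (k + l.+1 < N)%N -> a (k + l)%N = a (k + l).+1.
  elim: l => [|l ih] hl; first by rewrite addn0.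
  rewrite addnS; apply: braid_commute_eq; try by apply: hu; lia.
    by apply: hb; lia.
  by rewrite -ih; [apply: hc; lia | lia].
have down l : (l <= k)%N -> a (k - l)%N = a (k - l).+1.
  elim: l => [|l ih] hl; first by rewrite subn0.
  have -> : (k - l.+1).+1 = (k - l)%N by lia.
  have e2 : (k - l)%N = (k - l.+1).+1 by lia.
  apply: braid_commute_eq; try by apply: hu; lia.
    by rewrite e2; apply: hb; lia.
  by rewrite ih; [apply: hc; lia | lia].
apply: const_of_adjacent => i iN; case: (leqP i k) => hik.
  by have := down (k - i)%N; rewrite subKn //; apply; lia.
by have := up (i - k)%N; rewrite subnKC; [apply; lia | lia].
Qed.

(** The witness is the ordered product of all generators; conjugation by it moves each generator to
    the next. *)
Lemma braid_shift : exists2 D : 'M[F]_d, D \in unitmx &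
  forall i, (i.+1 < N)%N -> D *m a i = a i.+1 *m D.
Proof.
case: (ha) => hu hb hc.
pose D k := iteri k (fun i M => M *m a i) 1%:M.
have DS k : D k.+1 = D k *m a k by [].
have Dc k j : (k < j)%N -> (j < N)%N -> D k *m a j = a j *m D k.
  elim: k => [|k ih] kj jN; first by rewrite mul1mx mulmx1.
  by rewrite DS -mulmxA hc // mulmxA ih ?mulmxA //; lia.
exists (D N).
  have : (N <= N)%N by [].
  elim: {1 3}N => [|k ih] hk; first by rewrite unitmx1.
  by rewrite DS unitmx_mul ih ?hu //; lia.
move=> i; have : (N <= N)%N by [].
elim: {1 3 4 5}N => [|k ih] // hk ik.
case: (ltnP i.+1 k) => h.
  by rewrite DS -mulmxA -hc // mulmxA ih ?mulmxA //; lia.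
have ek : k = i.+1 by lia.
rewrite ek in hk *.
by rewrite !DS -!mulmxA (mulmxA (a i)) hb // !mulmxA Dc.
Qed.

Lemma braid_suffix (k : nat) : braid (N - k) (fun i => a (i + k)%N).
Proof.
case: ha => hu hb hc; split=> [i hi|i hi|i j ij jN].
- by apply: hu; lia.
- by apply: hb; lia.
- by apply: hc; lia.
Qed.

Lemma braid_prefix (M : nat) : (M <= N)%N -> braid M a.
Proof.
move=> MN; case: ha => hu hb hc; split=> [i hi|i hi|i j ij jN].
- by apply: hu; lia.
- by apply: hb; lia.
- by apply: hc; lia.
Qed.

Lemma braid_tr : braid N (fun i => (a i)^T).
Proof.
case: ha => hu hb hc; split=> [i hi|i hi|i j ij jN].
- by rewrite unitmx_tr hu.
- by rewrite -!trmx_mul !mulmxA hb.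
- by rewrite -!trmx_mul (hc i j).
Qed.

Lemma braid_scale (y : F) : y != 0 -> braid N (fun i => y *: a i).
Proof.
move=> y0; case: ha => hu hb hc; split=> [i hi|i hi|i j ij jN].
- by rewrite unitmxZ ?unitfE // hu.
- by rewrite -!scalemxAl -!scalemxAr -!scalemxAl hb.
- by rewrite -!scalemxAl -!scalemxAr (hc i j).
Qed.

Lemma braid_intertwine (k : nat) (S : 'M[F]_(k, d)) (b : nat -> 'M[F]_k) :
  row_free S -> (forall i, (i < N)%N -> S *m a i = b i *m S) -> braid N b.
Proof.
move=> fS hS; case: ha => hu hb hc.
have inj : injective (mulmx^~ S : 'M_k -> _) by apply: row_free_inj.
have h2 i j : (i < N)%N -> (j < N)%N -> b i *m b j *m S = S *m (a i *m a j).
  by move=> iN jN; rewrite mulmxA hS // -!mulmxA hS.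
split=> [i hi|i hi|i j ij jN].
- rewrite -row_free_unit /row_free -(mxrankMfree _ fS) -hS //.
  by rewrite mxrankMfree ?row_free_unit ?hu.
- have hi' : (i < N)%N by lia.
  have h3 j l : (j < N)%N -> (l < N)%N ->
      b j *m b l *m b j *m S = S *m (a j *m a l *m a j).
    by move=> jN lN; rewrite -!mulmxA (mulmxA (b l)) h2 // mulmxA -hS // !mulmxA.
  by apply: inj => /=; rewrite !h3 // hb.
- have iN : (i < N)%N by lia.
  by apply: inj => /=; rewrite !h2 // (hc i j).
Qed.

Lemma braid_restrict (U : 'M[F]_d) :
  (forall i, (i < N)%N -> stablemx U (a i)) ->
  exists (S : 'M[F]_(\rank U, d)) (b : nat -> 'M[F]_(\rank U)),
    [/\ row_free S, (S :=: U)%MS, braid N b &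
      forall i, (i < N)%N -> S *m a i = b i *m S].
Proof.
move=> sU.
pose b i := row_base U *m a i *m pinvmx (row_base U).
have hb i : (i < N)%N -> row_base U *m a i = b i *m row_base U.
  by move=> iN; rewrite mulmxKpV // stablemx_row_base sU.
exists (row_base U), b; split=> //.
- exact: row_base_free.
- exact: eq_row_base.
- by apply: braid_intertwine hb; apply: row_base_free.
Qed.

Lemma const_on_sub (U : 'M[F]_d) :
  (forall i, (i < N)%N -> stablemx U (a i)) -> const_dim N (\rank U) ->
  forall i j, (i < N)%N -> (j < N)%N -> U *m a i = U *m a j.
Proof.
move=> /braid_restrict[S [b [_ eS bb hb]]] cU i j iN jN.
have /submxP[Z e] : (U <= S)%MS by rewrite eS.
by rewrite e -!mulmxA !hb // (cU _ bb i j).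
Qed.

End Family.

(** The dual of the quotient by [U] is the annihilator [kermx U^T], stable under the transposes, so
    [const_on_sub] applies to it. *)
Lemma const_on_quotient (N d : nat) (a : nat -> 'M[F]_d) (U : 'M[F]_d) :
  braid N a -> (forall i, (i < N)%N -> stablemx U (a i)) ->
  const_dim N (d - \rank U) ->
  forall i j, (i < N)%N -> (j < N)%N -> (a i - a j <= U)%MS.
Proof.
move=> ha sU cU i j iN jN.
have sK l : (l < N)%N -> stablemx (kermx U^T) (a l)^T.
  move=> /sU/submxP[Z e].
  by apply/sub_kermxP; rewrite -mulmxA -trmx_mul e trmx_mul mulmxA mulmx_ker mul0mx.
have eK : kermx U^T *m (a i)^T = kermx U^T *m (a j)^T.
  by apply: (const_on_sub (braid_tr ha) sK) => //; rewrite mxrank_ker mxrank_tr.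
rewrite submxE; have /submxP[Y eY] : ((cokermx U)^T <= kermx U^T)%MS.
  by apply/sub_kermxP; rewrite -trmx_mul mulmx_coker trmx0.
apply/eqP; apply: trmx_inj; rewrite trmx_mul eY -mulmxA linearB /= mulmxBr eK.
by rewrite subrr mulmx0 trmx0.
Qed.

(* The commutator subgroup of a braid group on at least five strands is
   perfect, so it cannot act by non-trivial commuting unipotents. *)
Lemma const_of_nilpotent (N d : nat) (a : nat -> 'M[F]_d) :
  braid N a -> (3 < N)%N ->
  (forall i j k l, (i < N)%N -> (j < N)%N -> (k < N)%N -> (l < N)%N ->
     (a i - a j) *m (a k - a l) = 0) ->
  const_family N a.
Proof.
move=> ha N3 h; case: (ha) => hu hb hc.
suff e : a 2%N = a 3%N by apply: (const_of_adjacent_eq ha _ e).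
(* Both [a 2] and [a 3] commute with [x]. Once expanded and cancelled, their braid relation reads
   [2 D2 + D3 = D2 + 2 D3]. *)
set x := a 0%N; set D2 := a 2%N - x; set D3 := a 3%N - x.
have e2 : a 2%N = x + D2 by rewrite addrC subrK.
have e3 : a 3%N = x + D3 by rewrite addrC subrK.
have z22 : D2 *m D2 = 0 by apply: h; lia.
have z23 : D2 *m D3 = 0 by apply: h; lia.
have z32 : D3 *m D2 = 0 by apply: h; lia.
have z33 : D3 *m D3 = 0 by apply: h; lia.
have c2 : D2 *m x = x *m D2 by rewrite mulmxBl mulmxBr /x (hc 0%N 2%N) //; lia.
have c3 : D3 *m x = x *m D3 by rewrite mulmxBl mulmxBr /x (hc 0%N 3%N) //; lia.
have expand (u v : 'M[F]_d) : u *m x = x *m u -> v *m x = x *m v ->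
    u *m u = 0 -> u *m v = 0 -> v *m u = 0 ->
    (x + u) *m (x + v) *m (x + u) = x *m x *m (x + u + v + u).
  move=> cu cv uu uv vu.
  have -> : (x + u) *m (x + v) = x *m (x + u + v).
    by rewrite mulmxDl !mulmxDr uv cu addr0 addrAC.
  by rewrite -!mulmxA; congr mulmx;
     rewrite mulmxDr !mulmxDl uu vu !addr0 cu cv -!mulmxDr.
have := hb 2%N N3; rewrite e2 e3 expand // expand //.
move/(unitmx_injl (_ : x *m x \in unitmx)).
rewrite unitmx_mul hu ?(ltn_trans _ N3) // => /(_ isT).
move: D2 D3 {e2 e3 z22 z23 z32 z33 c2 c3} => D2 D3.
by rewrite -!addrA => /addrI; rewrite addrCA => /addrI/addrI ->.
Qed.

End Generalities.

(** * Images of [a i - 1] in an irreducible family *)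

Section Irreducible.
Variable F : fieldType.
Variables (N d : nat) (a : nat -> 'M[F]_d).
Hypothesis ha : braid N a.

Lemma const_on_nilpotent (U : 'M[F]_d) :
  (3 < N)%N -> (forall i, (i < N)%N -> stablemx U (a i)) ->
  (forall i j k l, (i < N)%N -> (j < N)%N -> (k < N)%N -> (l < N)%N ->
     U *m (a i - a j) *m (a k - a l) = 0) ->
  forall i j, (i < N)%N -> (j < N)%N -> U *m a i = U *m a j.
Proof.
move=> N3 /(braid_restrict ha)[S [b [fS eS bb hb]]] h i j iN jN.
have /submxP[Z eZ] : (U <= S)%MS by rewrite eS.
have /submxP[Y eY] : (S <= U)%MS by rewrite eS.
rewrite eZ -!mulmxA !hb //; congr (_ *m (_ *m _)).
apply: (const_of_nilpotent bb) => // {}i {}j k l {}iN {}jN kN lN.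
have hB i' j' : (i' < N)%N -> (j' < N)%N ->
    (b i' - b j') *m S = S *m (a i' - a j').
  by move=> hi hj; rewrite mulmxBl mulmxBr !hb.
apply: (row_free_inj fS); rewrite /= mul0mx -mulmxA hB // mulmxA hB //.
by rewrite eY -(mulmxA Y) -(mulmxA Y) h ?mulmx0.
Qed.

Local Notation X i := (a i - 1%:M).

Lemma far_comm_sub1 (i j : nat) :
  (i < N)%N -> (j < N)%N -> (i.+1 < j)%N || (j.+1 < i)%N ->
  X i *m X j = X j *m X i.
Proof.
move=> iN jN h; rewrite !mulmxBl !mulmxBr (braid_far_comm ha iN jN h).
by rewrite !mulmx1 !mul1mx !opprB addrACA [in RHS]addrACA; congr (_ + _); apply: addrC.
Qed.

Lemma rank_sub_scalar (y : F) (i : nat) : (i < N)%N ->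
  \rank (a i - y%:M) = \rank (a 0%N - y%:M).
Proof.
have [D uD hD] := braid_shift ha.
elim: i => // i ih iN; rewrite -ih; last lia.
have e := intertwine_sub_scalar y (hD i iN).
rewrite -(@mxrankMfree _ _ _ _ (a i.+1 - y%:M) D) ?row_free_unit // -e.
by rewrite eqmxMfull // row_full_unit.
Qed.

Lemma stable_sub1 (U : 'M[F]_d) (i : nat) : (U *m X i <= U)%MS -> stablemx U (a i).
Proof.
by move=> h; rewrite -[a i](subrK 1%:M) mulmxDr mulmx1 addmx_sub.
Qed.

(* All products X_i X_j at distance at least two coincide; the common row
   space is a proper invariant subspace. *)
Lemma far_product_eq0 : (4 < N)%N -> irreducible N a -> (\rank (X 0%N) < d)%N ->
  (forall i j, (1 < i < N)%N -> (1 < j < N)%N -> X 0%N *m X i = X 0%N *m X j) ->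
  (forall i j, (i.+2 < N)%N -> (j.+2 < N)%N ->
     X N.-1 *m X i = X N.-1 *m X j) ->
  forall i j, (i < N)%N -> (j < N)%N -> (i.+1 < j)%N || (j.+1 < i)%N ->
    X i *m X j = 0.
Proof.
move=> N4 irr rk h0 h1.
have [D uD hD] := braid_shift ha.
have hDX i : (i.+1 < N)%N -> D *m X i = X i.+1 *m D.
  by move=> iN; apply/intertwine_sub_scalar/hD.
(* Conjugation by [D] carries [h0] from [X 0] to every [X i]. *)
have hi i : forall j k, (i.+1 < j < N)%N -> (i.+1 < k < N)%N ->
    X i *m X j = X i *m X k.
  elim: i => [|i ih] [|j] [|k] // hj hk; first exact: h0.
  apply: (unitmx_inj uD).
  by rewrite -!mulmxA -!hDX ?mulmxA -?hDX -?mulmxA ?(ih j k) //; lia.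
pose Q := X 0%N *m X N.-1.
have hQ i j : (i.+1 < j)%N -> (j < N)%N -> X i *m X j = Q.
  move=> ij jN; rewrite (hi i j N.-1); try lia.
  rewrite far_comm_sub1; try lia.
  rewrite (h1 i 0%N) /Q; try lia.
  by rewrite far_comm_sub1 //; lia.
have QX k l : (k < N)%N -> (l < N)%N -> Q *m X k = Q *m X l.
  have Q2 k' l' : (1 < k' < N)%N -> (1 < l' < N)%N -> Q *m X k' = Q *m X l'.
    move=> hk hl; rewrite /Q far_comm_sub1; try lia.
    by rewrite -!mulmxA (h0 k' l').
  have Q3 k' l' : (k'.+2 < N)%N -> (l'.+2 < N)%N -> Q *m X k' = Q *m X l'.
    by move=> hk hl; rewrite /Q -!mulmxA (h1 k' l').
  have Q1 k' : (k' < N)%N -> Q *m X k' = Q *m X 2%N.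
    by case: (ltnP 1 k') => hk hk'; [apply: Q2; lia | apply: Q3; lia].
  by move=> kN lN; rewrite Q1 // [RHS]Q1.
(* As [Q = X 0 *m X 2] and [X 4] commutes with both factors, [Q *m X 4 = X 4 *m Q] lies in the row
   space of [Q]. *)
have sQ k : (k < N)%N -> stablemx Q (a k).
  move=> kN; apply: stable_sub1; rewrite (QX k 4%N) //.
  rewrite -(hQ 0%N 2%N) //; last lia.
  rewrite -mulmxA (@far_comm_sub1 2 4) //; last lia.
  rewrite mulmxA (@far_comm_sub1 0 4) //; last lia.
  by rewrite -mulmxA submxMl.
have Q0 : Q = 0.
  have [//|/eqP fQ] := irr Q sQ.
  have : (\rank Q <= \rank (X 0%N))%N by rewrite mxrankM_maxl.
  by rewrite fQ leqNgt rk.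
move=> i j iN jN /orP[] h; first by rewrite hQ.
by rewrite far_comm_sub1 ?h ?orbT // hQ.
Qed.

(** * Dimension bounds when distant products vanish *)

Section FarProductsVanish.
Hypothesis irr : irreducible N a.
Hypothesis far0 : forall i j, (i < N)%N -> (j < N)%N ->
  (i.+1 < j)%N || (j.+1 < i)%N -> X i *m X j = 0.
Hypothesis X0 : X 0%N != 0.

Let W k : 'M[F]_d := (\sum_(i < k) X i)%MS.

Let WS k : W k.+1 = (W k + X k)%MS.
Proof. by rewrite /W big_ord_recr. Qed.

Let X_neq0 i : (i < N)%N -> X i != 0.
Proof. by move=> iN; rewrite -mxrank_eq0 rank_sub_scalar // mxrank_eq0. Qed.

Let W_mono k l : (k <= l)%N -> (W k <= W l)%MS.
Proof.
move=> /subnK <-; elim: (l - k)%N => [|m ih]; first exact: submx_refl.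
by rewrite addSn WS (submx_trans ih) // addsmxSl.
Qed.

Let X_sub_W i k : (i < k)%N -> (X i <= W k)%MS.
Proof. by move=> ik; apply: submx_trans (W_mono ik); rewrite WS addsmxSr. Qed.

Lemma sum_images_full : (0 < N)%N -> row_full (W N).
Proof.
move=> N0; have [k kN| |//] := irr (U := W N).
  apply: stable_sub1; apply: submx_trans (X_sub_W kN); exact: submxMl.
move=> w0; have := X_sub_W N0; rewrite w0 submx0 => x0.
by have := X0; rewrite x0.
Qed.

(** If growth stops at [k], then [invmx D] preserves [W k], which therefore contains every image and
    is the whole space. But [X N.-1] is far from the first [k] generators and kills [W k]. *)
Lemma sum_images_grow k : (0 < k)%N -> (k.+1 < N)%N ->
  (\rank (W k) < \rank (W k.+1))%N.
Proof.
move=> k0 kN; rewrite ltnNge; apply/negP => le_rk.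
have W_le : (W k.+1 <= W k)%MS.
  by rewrite -(mxrank_leqif_sup (W_mono (leqnSn k))) eqn_leq le_rk mxrankS ?W_mono.
have [D uD hD] := braid_shift ha.
have hDX i : (i.+1 < N)%N -> X i *m invmx D = invmx D *m X i.+1.
  by move=> iN; apply/(intertwine_inv uD)/intertwine_sub_scalar/hD.
have all_le j : (j < N)%N -> (X j <= W k)%MS.
  elim: j => [|j ih] jN; first exact: X_sub_W.
  have -> : X j.+1 = D *m (X j *m invmx D).
    by rewrite hDX // mulKVmx.
  apply: mulmx_sub; apply: submx_trans (submxMr _ (ih _)) _; first lia.
  rewrite /W sumsmxMr; apply/sumsmx_subP => i _.
  have ik := ltn_ord i.
  rewrite hDX; last lia.
  by apply: mulmx_sub; apply: submx_trans (X_sub_W _) W_le; lia.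
have WN : (W N <= W k)%MS.
  by apply/sumsmx_subP => i _; apply: all_le.
have full : row_full (W k).
  rewrite -sub1mx (submx_trans _ WN) // sub1mx; apply: sum_images_full; lia.
have z : W k *m X N.-1 = 0.
  apply/eqP; rewrite -submx0 sumsmxMr; apply/sumsmx_subP => i _.
  by rewrite far0 ?submx_refl //; have := ltn_ord i; lia.
have := X_neq0 (i := N.-1); rewrite -mxrank_eq0 -(eqmxMfull _ full) z mxrank0 eqxx.
by move/(_ ltac:(lia)).
Qed.

Lemma sum_images_rank k l : (0 < k)%N -> (k + l < N)%N ->
  (\rank (W k) + l <= \rank (W (k + l)))%N.
Proof.
move=> k0; elim: l => [|l ih] h; first by rewrite !addn0.
have := @sum_images_grow (k + l); rewrite !addnS in h *.
have := ih ltac:(lia); move=> h1 /(_ ltac:(lia) ltac:(lia)); lia.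
Qed.

Lemma far_dim_bound1 : (1 < N)%N -> (\rank (X 0%N) + (N - 2) <= d)%N.
Proof.
move=> N1; have := @sum_images_rank 1 (N - 2) isT ltac:(lia).
have -> : \rank (W 1) = \rank (X 0%N) by rewrite WS /W big_ord0 adds0mx.
by move/leq_trans; apply; apply: rank_leq_col.
Qed.

(** Every index is far from 0 or from 3, so every [X k] kills the intersection. *)
Lemma images_disjoint03 : (3 < N)%N -> (X 0%N :&: X 3%N)%MS = 0.
Proof.
move=> N3; set U := (_ :&: _)%MS.
have UX k : (k < N)%N -> U *m X k = 0.
  move=> kN; case: (ltnP 1 k) => hk.
    have /submxP[Z ->] : (U <= X 0%N)%MS by apply: capmxSl.
    by rewrite -mulmxA far0 ?mulmx0 //; lia.
  have /submxP[Z ->] : (U <= X 3%N)%MS by apply: capmxSr.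
  by rewrite -mulmxA far0 ?mulmx0 //; lia.
have [k kN|//|fU] := irr (U := U); first by apply: stable_sub1; rewrite UX // sub0mx.
have N0 : (0 < N)%N by lia.
have := X_neq0 N0; rewrite -mxrank_eq0 -(eqmxMfull _ fU) UX //.
by rewrite mxrank0.
Qed.

(** Conjugation by [a 2 *m a 3] fixes [a 0] and sends [a 2] to [a 3], which reduces to the pair 0,
    3. With index 2 both images already lie in [W 3], which gains one dimension in the next
    bound. *)
Lemma images_disjoint02 : (3 < N)%N -> (X 0%N :&: X 2%N)%MS = 0.
Proof.
move=> N3; case: (ha) => hu hb hc; set g := a 2%N *m a 3%N.
have ug : g \in unitmx by rewrite unitmx_mul !hu //; lia.
have e2 : X 2%N *m invmx g = invmx g *m X 3%N.
  apply/(intertwine_inv ug)/intertwine_sub_scalar.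
  by rewrite /g hb // mulmxA.
have e0 : X 0%N *m invmx g = invmx g *m X 0%N.
  apply/(intertwine_inv ug)/intertwine_sub_scalar.
  rewrite /g -mulmxA -(hc 0%N 3%N) // !mulmxA -(hc 0%N 2%N) //; lia.
set U := (_ :&: _)%MS.
have : (U *m invmx g <= X 0%N :&: X 3%N)%MS.
  rewrite sub_capmx; apply/andP; split.
    by apply: submx_trans (submxMr _ (capmxSl _ _)) _; rewrite e0 submxMl.
  by apply: submx_trans (submxMr _ (capmxSr _ _)) _; rewrite e2 submxMl.
rewrite images_disjoint03 // submx0 => /eqP h.
by apply: (@unitmx_inj _ _ _ (invmx g)); rewrite ?unitmx_inv // mul0mx.
Qed.

Lemma far_dim_bound2 : (3 < N)%N -> ((\rank (X 0%N)).*2 + (N - 4) <= d)%N.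
Proof.
move=> N3; have h := @sum_images_rank 3 (N - 4) isT ltac:(lia).
apply: leq_trans (rank_leq_col (W (3 + (N - 4)))); apply: leq_trans h.
rewrite leq_add2r -addnn -{2}(@rank_sub_scalar 1 2); last lia.
rewrite -mxrank_disjoint_sum ?images_disjoint02 //; apply: mxrankS.
by rewrite addsmx_sub !X_sub_W.
Qed.

(** Serves to exclude rank one when [d = N.+1]. *)
Lemma dim_le_mul_rank : (0 < N)%N -> (d <= N * \rank (X 0%N))%N.
Proof.
move=> /sum_images_full/eqP fW; rewrite -[leqLHS]fW.
have : forall k, (k <= N)%N -> (\rank (W k) <= k * \rank (X 0%N))%N.
  elim=> [|k ih] kN; first by rewrite /W big_ord0 mxrank0.
  rewrite WS (leq_trans (mxrank_adds_leqif _ _)) // mulSn addnC.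
  by rewrite leq_add ?ih ?rank_sub_scalar //; lia.
by apply.
Qed.

End FarProductsVanish.
End Irreducible.

(** * Constancy in small dimension, and the corank *)

Section SmallDimension.
Variable F : numClosedFieldType.

Lemma const_dim_le1 (N d : nat) : (d <= 1)%N -> const_dim F N d.
Proof.
move=> d1 a ha; case: (ha) => hu hb _.
apply: const_of_adjacent => i iN; apply: braid_commute_eq.
- by apply: hu; lia.
- exact: hu.
- exact: hb.
case: d d1 a {ha hu hb} => [|[|//]] _ a; first by rewrite [LHS]flatmx0 [RHS]flatmx0.
by rewrite [a i]mx11_scalar scalar_mxC.
Qed.

Section Family.
Variables (N d : nat) (a : nat -> 'M[F]_d).
Hypothesis ha : braid N a.

(** Each difference [a i - a j] maps the space into [U] and vanishes on [U], so products of two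
    differences are zero. *)
Lemma const_of_filtration (U : 'M[F]_d) :
  (3 < N)%N -> (forall i, (i < N)%N -> stablemx U (a i)) ->
  const_dim F N (\rank U) -> const_dim F N (d - \rank U) -> const_family N a.
Proof.
move=> N3 sU cU cQ; apply: (const_of_nilpotent ha N3) => i j k l iN jN kN lN.
have /submxP[Z ->] := const_on_quotient ha sU cQ iN jN.
by rewrite -mulmxA mulmxBr (const_on_sub ha sU cU kN lN) subrr mulmx0.
Qed.

(** An eigenvector of the common matrix would span a proper invariant line. *)
Lemma irreducible_not_const : (1 < d)%N -> irreducible N a -> (0 < N)%N ->
  ~ const_family N a.
Proof.
move=> d1 irr N0 ca.
have [y /eigenvalueP[v ev v0]] := eigenvalue_closed (a 0%N) (ltnW d1).
have rk : \rank <<v>>%MS = 1%N by rewrite genmxE rank_rV v0.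
have [i iN|e|/eqP] := irr <<v>>%MS.
- rewrite (ca i 0%N) // (eqmx_stable _ (genmxE v)) ev.
  exact: scalemx_sub (submx_refl v).
- by move: rk; rewrite e mxrank0.
by rewrite rk => e; rewrite -e in d1.
Qed.

Lemma collinear_in_line (M : 'M[F]_d) (u v : 'rV[F]_d) :
  (d <= (\rank M).+1)%N -> u != 0 -> u *m M = 0 -> v *m M = 0 ->
  exists c, v = c *: u.
Proof.
move=> rk u0 uM vM; apply/sub_rVP.
have uK : (u <= kermx M)%MS by apply/sub_kermxP.
have vK : (v <= kermx M)%MS by apply/sub_kermxP.
apply: submx_trans vK _; rewrite -(mxrank_leqif_sup uK) eqn_leq mxrankS //=.
by rewrite mxrank_ker rank_rV u0; lia.
Qed.

(* If every eigenspace of the first generator is a line, a line fixed by it is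
   an eigenline of all distant generators, hence of the shift and of the
   whole group. *)
Lemma eigenspace_dim_ge2 : (1 < d)%N -> (3 < N)%N -> irreducible N a ->
  exists y, ((\rank (a 0%N - y%:M)%R).+2 <= d)%N.
Proof.
move=> d1 N3 irr; apply: contrapT => /forallNP H.
have rk y i : (i < N)%N -> (d <= (\rank (a i - y%:M)%R).+1)%N.
  by move=> iN; rewrite (rank_sub_scalar ha) // leqNgt; apply/negP/H.
have [hu hb hc] := ha.
have [y /eigenvalueP[v ev v0]] := eigenvalue_closed (a 0%N) (ltnW d1).
have ker i z (u : 'rV[F]_d) : u *m a i = z *: u -> u *m (a i - z%:M) = 0.
  by move=> e; rewrite mulmxBr e mul_mx_scalar subrr.
have eig i : (1 < i < N)%N -> exists2 c, v *m a i = c *: v & c != 0.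
  move=> hi; have N0 : (0 < N)%N by lia.
  have [|c e] := collinear_in_line (rk y _ N0) v0 (ker _ _ _ ev) (v := v *m a i).
    by apply: ker; rewrite -mulmxA -hc ?mulmxA ?ev ?scalemxAl //; lia.
  exists c => //; apply: contraNneq v0 => c0.
  apply/eqP/(@unitmx_inj _ _ _ (a i)); first by apply: hu; lia.
  by rewrite mul0mx e c0 scale0r.
have [m2 e2 n2] := eig 2%N ltac:(lia); have [m3 e3 n3] := eig 3%N ltac:(lia).
have e23 : m2 = m3.
  have := congr1 (mulmx v) (hb 2%N ltac:(lia)).
  rewrite !mulmxA !(e2, e3, =^~ scalemxAl) !scalerA => /eqP.
  rewrite -subr_eq0 -scalerBl scaler_eq0 (negPf v0) orbF subr_eq0 => /eqP.
  by rewrite [m3 * m2]mulrC => /(mulfI (mulf_neq0 n2 n3)).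
rewrite -{}e23 in e3.
have [D uD hD] := braid_shift ha.
(* From [D *m a 2 = a 3 *m D], the vector [v *m D] is in the [m2]-eigenspace of [a 2], which is the
   line of [v]. *)
have [|c ec] := collinear_in_line (rk m2 2%N ltac:(lia)) v0 (ker _ _ _ e2) (v := v *m D).
  by apply: ker; rewrite -mulmxA hD ?mulmxA ?e3 ?scalemxAl //; lia.
have c0 : c != 0.
  apply: contraNneq v0 => c0; apply/eqP/(unitmx_inj uD).
  by rewrite mul0mx ec c0 scale0r.
have up i : (i.+1 < N)%N -> v *m a i = m2 *: v -> v *m a i.+1 = m2 *: v.
  move=> iN e; apply: (unitmx_inj uD).
  by rewrite -mulmxA -hD // mulmxA ec -!scalemxAl e ec !scalerA mulrC.
have down i : (i.+1 < N)%N -> v *m a i.+1 = m2 *: v -> v *m a i = m2 *: v.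
  move=> iN e; apply: (scalerI c0).
  by rewrite scalemxAl -ec -mulmxA hD // mulmxA e -scalemxAl ec !scalerA mulrC.
have all_eig i : (i < N)%N -> v *m a i = m2 *: v.
  elim: i => [_|i ih iN]; last by apply: up => //; apply: ih; lia.
  have dn1 : v *m a 1%N = m2 *: v by apply: down => //; lia.
  by apply: down => //; lia.
have rv : \rank <<v>>%MS = 1%N by rewrite genmxE rank_rV v0.
have [i iN|e|/eqP] := irr <<v>>%MS.
- rewrite (eqmx_stable _ (genmxE v)) all_eig //.
  exact: scalemx_sub (submx_refl v).
- by move: rv; rewrite e mxrank0.
by rewrite rv => e; rewrite -e in d1.
Qed.

(** The generators far from an end generator commute with it and act on its image as a family of
    [N - 2] generators. Constancy there, at both ends, feeds [far_product_eq0]. *)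
Lemma far0_of_const_image : (4 < N)%N -> irreducible N a ->
  (\rank (a 0%N - 1%:M)%R < d)%N ->
  const_dim F (N - 2) (\rank (a 0%N - 1%:M)%R) ->
  forall i j, (i < N)%N -> (j < N)%N -> (i.+1 < j)%N || (j.+1 < i)%N ->
    (a i - 1%:M) *m (a j - 1%:M) = 0.
Proof.
move=> N4 irr rk cX; apply: (far_product_eq0 ha) => //.
- move=> i j hi hj; rewrite !mulmxBr; congr (_ - _).
  have sX l : (l < N - 2)%N -> stablemx (a 0%N - 1%:M) (a (l + 2)%N).
    move=> hl; apply: comm_mx_stable; apply: comm_mx_sym.
    apply: comm_mxB; last exact: comm_mx1.
    by apply: (braid_far_comm ha); lia.
  have := const_on_sub (braid_suffix ha 2) sX cX.
  move/(_ (i - 2)%N (j - 2)%N ltac:(lia) ltac:(lia)).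
  by rewrite !subnK //; lia.
- move=> i j hi hj; rewrite !mulmxBr; congr (_ - _).
  have sX l : (l < N - 2)%N -> stablemx (a N.-1 - 1%:M) (a l).
    move=> hl; apply: comm_mx_stable; apply: comm_mx_sym.
    apply: comm_mxB; last exact: comm_mx1.
    by apply: (braid_far_comm ha); lia.
  apply: (const_on_sub (braid_prefix ha (leq_subr 2 N)) sX); try lia.
  by rewrite (rank_sub_scalar ha) //; lia.
Qed.

Lemma irreducible_scale (y : F) : y != 0 -> irreducible N a ->
  irreducible N (fun i => y *: a i).
Proof.
move=> y0 irr U sU; apply: irr => i iN.
by have := sU i iN; rewrite -scalemxAr (eqmx_scale _ y0).
Qed.

Lemma rank_normalize (y : F) (i : nat) : y != 0 ->
  \rank (y^-1 *: a i - 1%:M) = \rank (a i - y%:M)%R.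
Proof.
move=> y0; rewrite -(eqmx_scale (_ - _) y0) scalerBr scalerA mulfV // scale1r.
by rewrite scalemx1.
Qed.

End Family.

Lemma small_dim_const (d N : nat) : (3 < N)%N -> (d.+2 <= N)%N -> const_dim F N d.
Proof.
elim/ltn_ind: d N => d IH N N3 dN a ha.
have [d1|d1] := leqP d 1; first exact: const_dim_le1 ha.
case: (pselect (irreducible N a)) => [irr|]; last first.
  move=> /existsNP[U /not_implyP[sU /not_orP[/eqP U0 fU]]].
  have rU : (\rank U < d)%N.
    by rewrite ltn_neqAle rank_leq_col andbT; apply/negP.
  rewrite -mxrank_eq0 -lt0n in U0.
  by apply: (const_of_filtration ha N3 sU); apply: IH => //; lia.
have [y] := eigenspace_dim_ge2 ha d1 N3 irr.
set X : 'M[F]_d := a 0%N - y%:M => rX.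
case: (ha) => hu hb hc.
have sX l : (l < N - 2)%N -> stablemx X (a (l + 2)%N).
  move=> hl; apply: comm_mx_stable; apply: comm_mx_sym.
  apply: comm_mxB; last exact: comm_mx_scalar.
  by apply: (braid_far_comm ha); lia.
(* Rank at least 2 forces [4 <= d], so [6 <= N]; the image of [X] and its quotient, both of
   dimension at most [d - 2], then fall under the induction hypothesis for [N - 2] generators. *)
have [r1|r1] := leqP 2 (\rank X).
  suff cG : const_family (N - 2) (fun i => a (i + 2)%N).
    by apply: (const_of_adjacent_eq ha (k := 2)) => //; apply: (cG 0%N 1%N); lia.
  by apply: (const_of_filtration (braid_suffix ha 2) _ sX); [|apply: IH..]; lia.
have [r0|r0] := eqVneq X 0.
  apply: (const_of_adjacent_eq ha (k := 0)); first lia.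
  apply: braid_commute_eq; [apply: hu; lia|apply: hu; lia|apply: hb; lia|].
  by rewrite (subr0_eq r0) scalar_mxC.
have y0 : y != 0.
  apply: contraTneq rX => y0; rewrite /X y0 raddf0 subr0 mxrank_unit ?hu //; lia.
(* In rank one, [far_dim_bound1] gives [1 + (N - 2) <= d], against [d.+2 <= N]. *)
exfalso; pose b i := y^-1 *: a i.
have yV0 : y^-1 != 0 by rewrite invr_eq0.
have bb : braid N b := braid_scale ha yV0.
have ib : irreducible N b := irreducible_scale yV0 irr.
have rb : \rank (b 0%N - 1%:M)%R = \rank X := rank_normalize a 0 y0.
have f0 : forall i j, (i < N)%N -> (j < N)%N -> (i.+1 < j)%N || (j.+1 < i)%N ->
    (b i - 1%:M) *m (b j - 1%:M) = 0.
  apply: (far0_of_const_image bb) => //; rewrite ?rb; try lia.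
    by rewrite -mxrank_eq0 in r0; lia.
  by apply: const_dim_le1; lia.
have nb : b 0%N - 1%:M != 0 by rewrite -mxrank_eq0 rb mxrank_eq0.
have := far_dim_bound1 bb ib f0 nb ltac:(lia).
by move: r0; rewrite rb -mxrank_eq0; lia.
Qed.

Lemma irreducible_corank2 (N d : nat) (a : nat -> 'M[F]_d) :
  (7 < N)%N -> d = N.+1 -> braid N a -> irreducible N a ->
  exists2 y, y != 0 & \rank (a 0%N - y%:M)%R = 2%N.
Proof.
move=> N7 dN ha irr; case: (ha) => hu hb hc.
have N0 : (0 < N)%N by lia.
have nconst : ~ const_family N a by apply: irreducible_not_const => //; lia.
(* The threshold 4 suits [small_dim_const] for [N - 2] generators on both sides: images of rank at
   most 4 qualify since [8 <= N], and rank at least 5 leaves quotients of dimension at most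
   [N - 4]. *)
have [[y]|/forallNP H] := pselect (exists y, (\rank (a 0%N - y%:M)%R <= 4)%N).
  set X : 'M[F]_d := a 0%N - y%:M => rX.
  have y0 : y != 0.
    apply: contraTneq rX => y0; rewrite /X y0 raddf0 subr0 mxrank_unit ?hu //; lia.
  exists y => //; rewrite -/X; pose b i := y^-1 *: a i.
  have yV0 : y^-1 != 0 by rewrite invr_eq0.
  have bb : braid N b := braid_scale ha yV0.
  have ib : irreducible N b := irreducible_scale yV0 irr.
  have rb : \rank (b 0%N - 1%:M)%R = \rank X := rank_normalize a 0 y0.
  have f0 : forall i j, (i < N)%N -> (j < N)%N -> (i.+1 < j)%N || (j.+1 < i)%N ->
      (b i - 1%:M) *m (b j - 1%:M) = 0.
    apply: (far0_of_const_image bb) => //; rewrite ?rb; try lia.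
    by apply: small_dim_const; lia.
  have nb : b 0%N - 1%:M != 0.
    apply/eqP => e; apply: nconst; apply: (const_of_adjacent_eq ha (k := 0)); first lia.
    apply: braid_commute_eq; [apply: hu; lia|apply: hu; lia|apply: hb; lia|].
    by apply: (scalerI yV0); rewrite scalemxAl scalemxAr -/(b 0%N) (subr0_eq e) scalar_mxC.
  (* With [r] the rank, [2 r + (N - 4) <= N + 1] gives [r <= 2], and [N + 1 <= N r] gives
     [r >= 2]. *)
  have := far_dim_bound2 bb ib f0 nb ltac:(lia).
  have := dim_le_mul_rank bb ib nb N0.
  by rewrite rb; case: (\rank X) => [|[|[|r]]]; lia.
exfalso; apply: nconst.
have e2 : a 2%N = a 3%N; last by apply: (const_of_adjacent_eq ha (k := 2)) => //; lia.
have bG := braid_suffix ha 2.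
have cG l : (l < N - 2)%N -> comm_mx (a (l + 2)%N) (a 0%N).
  by move=> hl; apply: (braid_far_comm ha); lia.
have cGs z l : (l < N - 2)%N -> comm_mx (a (l + 2)%N) (a 0%N - z%:M).
  by move=> hl; apply: comm_mxB; [apply: cG|apply: comm_mx_scalar].
have quo z i j : (i < N - 2)%N -> (j < N - 2)%N ->
    (a (i + 2)%N - a (j + 2)%N <= a 0%N - z%:M)%MS.
  apply: (const_on_quotient bG).
    by move=> l hl; apply: comm_mx_stable; apply: comm_mx_sym; apply: cGs.
  by apply: small_dim_const; have := H z; lia.
(* Descending induction along the images of the partial products of the
   characteristic polynomial. *)
case: d dN a ha irr hu hb hc H bG cG cGs quo => // d' dN a ha irr hu hb hc H bG cG cGs quo.
have red s : (forall i j, (i < N - 2)%N -> (j < N - 2)%N ->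
    (\prod_(z <- s) (a 0%N - z%:M)) *m (a (i + 2)%N - a (j + 2)%N) = 0) ->
    a 2%N = a 3%N.
  elim: s => [|z s ih] hs.
    have := hs 0%N 1%N ltac:(lia) ltac:(lia); rewrite big_nil mul1mx.
    exact: subr0_eq.
  have cP l : (l < N - 2)%N ->
      comm_mx (a (l + 2)%N) (\prod_(z <- s) (a 0%N - z%:M)).
    move=> hl; elim/big_rec: _ => [|w M _ hM]; first exact: comm_mx1.
    by apply: comm_mxM => //; apply: cGs.
  apply: ih => i j hi hj; rewrite mulmxBr; apply/eqP; rewrite subr_eq0; apply/eqP.
  apply: (const_on_nilpotent bG) => //; first lia.
    by move=> l hl; apply: comm_mx_stable; apply: comm_mx_sym; apply: cP.
  move=> i1 j1 k l hi1 hj1 hk hl.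
  (* The first difference commutes with [P] and factors as [Z *m (a 0 - z)]; this restores the
     missing factor, so [hs] kills the product. *)
  set P := \prod_(z <- s) _.
  have -> : P *m (a (i1 + 2)%N - a (j1 + 2)%N) = (a (i1 + 2)%N - a (j1 + 2)%N) *m P.
    by rewrite mulmxBl mulmxBr !cP.
  have /submxP[Z ->] := quo z i1 j1 hi1 hj1.
  have := hs k l hk hl; rewrite big_cons -!mulmxA => h.
  by rewrite h mulmx0.
(* The descent starts from all roots of the characteristic polynomial, where the product vanishes by
   Cayley-Hamilton. *)
have [s es] := closed_field_poly_normal (char_poly (a 0%N)).
apply: (red s) => i j _ _.
have -> : \prod_(z <- s) (a 0%N - z%:M) = 0; last by rewrite mul0mx.
rewrite -(Cayley_Hamilton (a 0%N)) es (monicP (char_poly_monic _)) scale1r.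
rewrite rmorph_prod; apply: eq_bigr => z _.
by rewrite rmorphB /= horner_mx_X horner_mx_C.
Qed.

End SmallDimension.

Theorem theorem3 (n : nat) (A : 'I_n.-1 -> 'M[C]_n) :
  (9 <= n)%N -> braid_rep A -> braid_irreducible A ->
  exists (y : C) (B : 'I_n.-1 -> 'M[C]_n) (P : 'M[C]_n),
    [/\ y != 0, P \in unitmx, braid_rep B, braid_corank B 2
      & forall i, A i = invmx P *m (y *: B i) *m P].
Proof.
case: n A => [|[|n]] // A n9 [hu hb hc] irr.
(* Out of range, [inord] returns a default index; [braid] and [irreducible] only look below
   [n.+1]. *)
pose a i := A (inord i).
have aE (i : 'I_n.+1) : A i = a i by rewrite /a inord_val.
have ba : braid n.+1 a.
  split=> [i iN|i iN|i j ij jN]; first exact: hu.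
    by apply: hb; rewrite !inordK ?addn1 //; lia.
  by apply: hc; rewrite !inordK ?addn2 //; lia.
have ia : irreducible n.+1 a.
  move=> U sU; have [|/eqmx0P ->|] := irr U; [|by left|by right].
  by move=> i; rewrite aE; apply: sU.
have [y y0 ry] := irreducible_corank2 (n9 : (7 < n.+1)%N) (erefl _) ba ia.
have yV0 : y^-1 != 0 by rewrite invr_eq0.
(* Rescaling alone suffices, so the change of basis is the identity. *)
exists y, (fun i => y^-1 *: A i), 1%:M; split=> //.
- exact: unitmx1.
- split=> [i|i j ij|i j ij].
  + by rewrite unitmxZ ?unitfE.
  + by rewrite -!scalemxAl -!scalemxAr -!scalemxAl hb.
  + by rewrite -!scalemxAl -!scalemxAr hc.
- by move=> i i0; rewrite aE (rank_normalize a _ y0) i0.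
- by move=> i; rewrite invmx1 mul1mx mulmx1 scalerA mulfV // scale1r.
Qed.
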